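(* Assume the standing setting with $\Omega$ of type (1). Then $z=\mathfrak S_a(x)$ is a bijective conformal (biholomorphic) map from $\Omega$ onto the upper half-plane $\mathbb C_+=\{z\in\mathbb C:\operatorname{Im}z>0\}$.
   Context: Let $Q$ be a complex polynomial of degree $m\ge 1$. A turning point is a zero of $Q$. For a turning point $a$, $\mathfrak S_a(x)=\int_a^x\sqrt{Q(\tau)}\,d\tau$. The Stokes curves emanating from a turning point $a$ are the arcs of $\{x:\operatorname{Im}\mathfrak S_a(x)=0\}$ starting at $a$; each ends at $\infty$ or at another turning point (a Stokes curve ending at a turning point $b$ is joined with the Stokes curves emanating from $b$). The Stokes curves divide $\mathbb C$ into regions called Stokes domains. Standing setting: $\Omega$ is a Stokes domain, $a\in\partial\Omega$ is a turning point, a holomorphic branch of $\sqrt Q$ on $\Omega$ is fixed so that $\mathfrak S_a$ is holomorphic on $\Omega$ with $\mathfrak S_a'=\sqrt Q$, and $\operatorname{Im}\mathfrak S_a(x)>0$ for all $x\in\Omega$. Moreover $\Omega$ is of one of two types: type (1): $\partial\Omega$ is a single connected curve containing $a$, and $\operatorname{Im}\mathfrak S_a=0$ on $\partial\Omega$; type (2): $\partial\Omega=\mathcal C_1\cup\mathcal C_2$ with $\mathcal C_1\cap\mathcal C_2=\emptyset$, there are turning points $a\in\mathcal C_1$, $b\in\mathcal C_2$, $\operatorname{Im}\mathfrak S_a=0$ on $\mathcal C_1$ and $\operatorname{Im}\mathfrak S_a=\operatorname{Im}\mathfrak S_a(b)$ on $\mathcal C_2$. *)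

(* Defs.v *)
From HB Require Import structures.
From mathcomp Require Import all_boot all_order all_algebra.
From mathcomp Require Import all_classical all_reals all_analysis.
From mathcomp Require Import complex.
Set Implicit Arguments. Unset Strict Implicit. Unset Printing Implicit Defensive.
Import Order.TTheory GRing.Theory Num.Theory.
Import numFieldNormedType.Exports.
Local Open Scope ring_scope.
Local Open Scope classical_set_scope.

(* The complex plane, as a normed module over itself, so that
   [derivable f x 1] / ['D_1 f x] is complex differentiability / the complex
   derivative. *)
Notation Cx R := ((R[i])^o).

Definition turning_point (R : realType) (Q : {poly R[i]}) (a : Cx R) : Prop :=
  root Q a.

(* A (piece of a) Stokes curve emanating from the turning point a, parametrized
   by t in [0,T) as gamma(t) = u t + i v t, gamma(0+) = a, gamma(t) not a
   turning point for 0 < t < T, and Im S_a constant along gamma, i.e.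
   sqrt(Q(gamma)) gamma' real, i.e. Q(gamma(t)) * gamma'(t)^2 >= 0. *)
Definition stokes_arc (R : realType) (Q : {poly R[i]}) (a : Cx R) (T : R)
    (u v : R -> R) : Prop :=
  [/\ turning_point Q a, 0 < T,
      u t @[t --> 0^'+] --> complex.Re a,
      v t @[t --> 0^'+] --> complex.Im a &
      forall t, 0 < t < T ->
        [/\ derivable u t 1, derivable v t 1,
            ~ turning_point Q (Complex (u t) (v t)) &
            0 <= Q.[Complex (u t) (v t)] * (Complex ('D_1 u t) ('D_1 v t)) ^+ 2]].

Definition stokes_graph (R : realType) (Q : {poly R[i]}) : set (Cx R) :=
  [set x | turning_point Q x] `|`
  [set x | exists a T u v, stokes_arc Q a T u v /\
             exists t, 0 < t < T /\ x = Complex (u t) (v t)].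

Definition stokes_domain (R : realType) (Q : {poly R[i]}) (Omega : set (Cx R))
  : Prop :=
  exists x, ~ stokes_graph Q x /\
            Omega = connected_component (~` stokes_graph Q) x.

Definition bdry (R : realType) (A : set (Cx R)) : set (Cx R) :=
  closure A `\` A°.

Definition upper_half_plane (R : realType) : set (Cx R) :=
  [set z | 0 < complex.Im z].

(* Main.v *)
(** [S] is a locally injective holomorphic map whose derivative has modulus
    [|Q|^(1/2)].  Since [Q] is bounded below near infinity, a path in [Omega]
    whose [S]-image is a segment stays bounded; since [Im S] vanishes on the
    boundary, it stays away from the boundary as long as its image stays away
    from the real axis.  So local inverses of [S] exist on discs of a uniform
    radius along such paths, and a local inverse at [S x0] extends to every
    bounded convex part of a half-plane [Im z >= c > 0], by dilating that part
    from the centre [S x0].  Exhausting the upper half-plane gives a global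
    section [g] of [S], and the set where [g (S x) = x] is open and closed in
    the connected set [Omega]. *)
Require Import Defs.
From HB Require Import structures.
From mathcomp Require Import all_boot all_order all_algebra.
From mathcomp Require Import all_classical all_reals all_analysis.
From mathcomp Require Import complex ring lra.
Set Implicit Arguments. Unset Strict Implicit. Unset Printing Implicit Defensive.
Import Order.TTheory GRing.Theory Num.Theory.
Import numFieldNormedType.Exports.
Import ComplexField.Normc.
Local Open Scope ring_scope.
Local Open Scope classical_set_scope.

(** * The real-valued modulus on the complex numbers *)

Section Modulus.
Context {R : realType}.
Implicit Types x y z w : R[i].

Lemma normc_norm z : (normc z)%:C%C = `|z|.
Proof. by rewrite normc_def; case: z. Qed.

Lemma normc_ge0 z : 0 <= normc z.
Proof. by case: z => u v; exact: sqrtr_ge0. Qed.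

Lemma normcD x y : normc (x + y) <= normc x + normc y.
Proof. exact: le_normcD. Qed.

Lemma normcB x y : normc (x - y) = normc (y - x).
Proof. by rewrite -[in RHS](opprB x y) normcN. Qed.

Lemma ler_normcB x y : normc x - normc y <= normc (x - y).
Proof. by have := normcD (x - y) y; rewrite subrK; lra. Qed.

Lemma normc_triangle z x y : normc (x - y) <= normc (x - z) + normc (z - y).
Proof. by rewrite -[x - y](subrKA z); exact: normcD. Qed.

Lemma normc_eq0 z : (normc z == 0) = (z == 0).
Proof. by apply/eqP/eqP => [|->]; [exact: eq0_normc | exact: normc0]. Qed.

Lemma normc_gt0 z : (0 < normc z) = (z != 0).
Proof. by rewrite lt_neqAle eq_sym normc_eq0 normc_ge0 andbT. Qed.

Lemma normc_real (r : R) : normc (r%:C)%C = `|r|.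
Proof. by rewrite /= expr0n addr0 sqrtr_sqr. Qed.

Lemma ler_norm_Re z : `|complex.Re z| <= normc z.
Proof. by have := normc_ge_Re z; rewrite -normc_norm lecR. Qed.

Lemma ler_norm_Im z : `|complex.Im z| <= normc z.
Proof.
case: z => u v /=; rewrite -[`|v|]sqrtr_sqr ler_sqrt; last by nra.
by rewrite lerDr sqr_ge0.
Qed.

Lemma normc_i : normc ('i%C : R[i]) = 1.
Proof. by rewrite /= expr0n expr1n add0r sqrtr1. Qed.

Lemma normc_le_ReIm z : normc z <= `|complex.Re z| + `|complex.Im z|.
Proof.
rewrite {1}(complexE z) (le_trans (normcD _ _))// normcM normc_i mul1r.
by rewrite !normc_real.
Qed.

End Modulus.

(** * Translation of the library's topology and derivatives into real epsilon-delta form *)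

Section Bridge.
Context {R : realType}.
Implicit Types x y z w : R[i].

(** Balls of [Cx R] have complex radii; a positive one has zero imaginary part, so real radii
    suffice. *)
Lemma nbhs_normc (x : Cx R) (A : set (Cx R)) :
  nbhs x A <-> exists2 e : R, 0 < e & forall y : R[i], normc (y - x) < e -> A y.
Proof.
split.
  case/nbhs_ballP => e /= e0 xeA; exists (complex.Re e); first by move: e0; rewrite ltcE => /andP[].
  move=> y xye; apply: xeA; rewrite -ball_normE /=.
  move: e0; rewrite ltcE /= => /andP[/eqP ime _].
  rewrite -[`|_|]normc_norm ltcE /= -ime eqxx /=.
  by rewrite normcB.
case=> e e0 xeA; apply/nbhs_ballP; exists (e%:C)%C => /=; first by rewrite ltcR.
move=> y; rewrite -ball_normE /= -[`|_|]normc_norm ltcR => xye; apply: xeA.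
by rewrite normcB.
Qed.

(** Complex differentiability without a quotient, so that [y = x] needs no exception. *)
Definition cdiff (f : R[i] -> R[i]) x d := forall e : R, 0 < e ->
  exists2 r : R, 0 < r & forall y, normc (y - x) < r ->
    normc (f y - f x - d * (y - x)) <= e * normc (y - x).

Lemma derivable_cdiff (f : Cx R -> Cx R) (x : Cx R) :
  derivable f x 1 -> cdiff f x ('D_1 f x).
Proof.
move=> /[dup] fx1; rewrite /derivable /derive.
set d := lim _ => /cvg_ex [l /[dup] cl /cvg_lim dl] e e0.
have {dl} -> : d = l by exact: dl.
have /cvgrPdist_le/(_ (e%:C)%C) := cl.
rewrite ltcR => /(_ e0).
rewrite /prop_near1 /= /dnbhs /within /= => /nbhs_normc[r r0 rP].
exists r => // y yr.
have [->|xy] := eqVneq y x.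
  by rewrite !subrr mulr0 subr0 normc0 mulr0.
have yx0 : y - x != 0 by rewrite subr_eq0.
have := rP (y - x); rewrite subr0 => /(_ yr yx0).
rewrite /shift /= -[`|_|]normc_norm lecR.
rewrite [_ *: 1]mulr1 subrK => H.
have -> : f y - f x - l * (y - x) = - (l - (y - x)^-1 * (f y - f x)) * (y - x).
  by field.
by rewrite normcM normcN ler_wpM2r// normc_ge0.
Qed.

Lemma cdiff_derivable (f : Cx R -> Cx R) (x d : Cx R) :
  cdiff f x d -> derivable f x 1.
Proof.
move=> fxd; rewrite /derivable; apply/cvg_ex; exists d.
apply/cvgrPdist_le => e; rewrite ltcE /= => /andP[/eqP ime e0].
have [r r0 rP] := fxd _ e0.
rewrite /prop_near1 /= /dnbhs /within /=; apply/nbhs_normc; exists r => // h.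
rewrite subr0 => hr h0.
have := rP (h + x); rewrite addrK => /(_ hr) H.
rewrite /shift /= -[`|_|]normc_norm lecE /= ime eqxx /= [_ *: 1]mulr1.
have -> : d - (h^-1 * (f (h + x) - f x)) = - (f (h + x) - f x - d * h) * h^-1.
  by field.
by rewrite normcM normcN normcV ler_pdivrMr// normc_gt0.
Qed.

(** Compactness of the closed square of half-side [M] about [k]: a local positive constant that may
    always be shrunk can be chosen uniformly. *)
Lemma box_unif (P : R -> R[i] -> Prop) (k : R[i]) (M : R) :
  (forall s t x, 0 < s -> s <= t -> P t x -> P s x) ->
  (forall x, `|complex.Re (x - k)| <= M -> `|complex.Im (x - k)| <= M ->
    exists e r : R, [/\ 0 < e, 0 < r & forall y, normc (y - x) < e -> P r y]) ->
  exists2 r : R, 0 < r & forall x,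
    `|complex.Re (x - k)| <= M -> `|complex.Im (x - k)| <= M -> P r x.
Proof.
move=> Pmono Ploc.
pose K := `[- M, M]%classic `*` `[- M, M]%classic : set (R * R)%type.
have cK : compact K by apply: compact_setX; exact: segment_compact.
(* The covering form of compactness is used with the filter of positive reals tending to 0. *)
have /compact_near_coveringP/(_ _ (0 : R)^'+
  (fun r p => P r (Complex p.1 p.2 + k))) := cK.
case=> [[p q] /= [pM qM]|].
  have [||e [r [e0 r0 erP]]] := Ploc (Complex p q + k).
  - by move: pM; rewrite addrK /= ler_norml in_itv.
  - by move: qM; rewrite addrK /= ler_norml in_itv.
  exists ([set y : R * R | ball p (e / 2) y.1 /\ ball q (e / 2) y.2],
          [set s : R | 0 < s <= r]) => /=.
    split.
      exists (ball p (e / 2), ball q (e / 2)) => //=.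
      by split; apply: nbhsx_ballx; rewrite divr_gt0.
    near=> s; apply/andP; split; first by [].
    by near: s; exact: nbhs_right_le.
  move=> [[p' q'] s] /= [[]]; rewrite /ball /= => pp' qq' /andP[s0 sr].
  apply: (Pmono _ r) => //; apply: erP.
  rewrite opprD addrACA subrr addr0 (le_lt_trans (normc_le_ReIm _))//=.
  by rewrite (distrC p') (distrC q'); lra.
move=> e /= e0 eP; exists (e / 2); first by rewrite divr_gt0.
move=> x xk1 xk2.
have : P (e / 2) (Complex (complex.Re (x - k)) (complex.Im (x - k)) + k).
  apply: (eP (e / 2) _ _ (complex.Re (x - k), complex.Im (x - k))).
  - by rewrite /ball_ /= sub0r normrN gtr0_norm ?divr_gt0//; lra.
  - by rewrite divr_gt0.
  - by split; rewrite /= in_itv /= -ler_norml.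
suff -> : Complex (complex.Re (x - k)) (complex.Im (x - k)) + k = x by [].
by rewrite -[RHS](subrK k); case: (x - k).
Unshelve. all: by end_near. Qed.
End Bridge.

(** * Induction along the unit interval and mean value estimates *)

Section RealInduction.
Context {R : realType}.

Lemma real_induction (P : R -> Prop) :
  P 0 ->
  (forall t, 0 <= t < 1 -> P t ->
    exists2 r : R, 0 < r & forall s, t < s < t + r -> s <= 1 -> P s) ->
  (forall t, 0 < t <= 1 -> (forall s, 0 <= s < t -> P s) -> P t) ->
  forall t, 0 <= t <= 1 -> P t.
Proof.
move=> P0 Pright Pleft.
(* The supremum of [A] belongs to [A] by the left-limit hypothesis, and were it below 1 the
   right-extension hypothesis would exceed it. *)
pose A := [set t : R | 0 <= t <= 1 /\ forall s, 0 <= s <= t -> P s].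
have A0 : A 0.
  by split=> [|s]; [lra | rewrite -eq_le => /eqP <-].
have hsA : has_sup A by split; [exists 0 | exists 1 => t [/andP[]]].
have A_ub t : A t -> t <= sup A by move=> At; exact: sup_upper_bound.
have T0 : 0 <= sup A by exact: A_ub.
have T1 : sup A <= 1 by apply: ge_sup; [exists 0 | move=> t [/andP[]]].
have PltT s : 0 <= s < sup A -> P s.
  move=> /andP[s0 sT]; have e0 : 0 < sup A - s by rewrite subr_gt0.
  have [t [_ Pt] st] := sup_adherent e0 hsA.
  by apply: Pt; rewrite s0 /=; lra.
have PT : P (sup A).
  have [T0'|T0'] := eqVneq (sup A) 0; first by rewrite T0'.
  by apply: Pleft => //; rewrite T1 lt_neqAle eq_sym T0' T0.
have PleT s : 0 <= s <= sup A -> P s.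
  move=> /andP[s0]; rewrite le_eqVlt => /orP[/eqP -> //|sT].
  by apply: PltT; rewrite s0 sT.
have [T_lt1|T_ge1] := ltP (sup A) 1; last first.
  by move=> t /andP[t0 t1]; apply: PleT; rewrite t0 (le_trans t1).
have [|r r0 rP] := Pright (sup A) _ PT; first by rewrite T0.
pose u := Num.min 1 (sup A + r / 2).
have uT : sup A < u by rewrite lt_min T_lt1 /=; lra.
have u1 : u <= 1 by rewrite ge_min lexx.
have ur : u <= sup A + r / 2 by rewrite ge_min lexx orbT.
suff /A_ub : A u by rewrite leNgt uT.
split=> [|s /andP[s0 su]]; first by rewrite u1 andbT; lra.
have [sT|sT] := leP s (sup A); first by apply: PleT; rewrite s0.
by apply: rP; [rewrite sT /=; lra | exact: le_trans u1].
Qed.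

(** The local bounds only compare with the centre [t]; real induction chains them into a bound from
    0. *)
Lemma lipschitz_local_global (F : R -> R[i]) (L : R) :
  (forall t, 0 <= t <= 1 -> exists2 r : R, 0 < r &
    forall s, 0 <= s <= 1 -> `|s - t| < r -> normc (F s - F t) <= L * `|s - t|) ->
  normc (F 1 - F 0) <= L.
Proof.
move=> Floc.
suff H t : 0 <= t <= 1 -> normc (F t - F 0) <= L * t.
  by rewrite -[leRHS]mulr1; apply: H; lra.
apply: (@real_induction (fun t => normc (F t - F 0) <= L * t)) => {t}.
- by rewrite subrr normc0 mulr0.
- move=> t /andP[t0 t1] Pt; have [|r r0 rP] := Floc t; first by lra.
  exists r => // s /andP[ts sr] s1; have := normc_triangle (F t) (F s) (F 0).
  by have := rP s; rewrite gtr0_norm ?subr_gt0// => /(_ _ _); nra.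
- move=> t /andP[t0 t1] Pt; have [|r r0 rP] := Floc t; first by lra.
  pose s := Num.max 0 (t - r / 2).
  have s0 : 0 <= s by rewrite le_max lexx.
  have st : s < t by rewrite gt_max t0 /=; lra.
  have sr : t - r / 2 <= s by rewrite le_max lexx orbT.
  have Ps : normc (F s - F 0) <= L * s by apply: Pt; rewrite s0.
  have := rP s; rewrite ltr0_norm ?subr_lt0// (normcB (F s)) => /(_ _ _).
  by have := normc_triangle (F s) (F t) (F 0); nra.
Qed.

(** Mean value inequality for [f] minus its linear model of slope [q]: along the segment this
    difference is locally Lipschitz with constant [B * normc h + e] for every positive [e]. *)
Lemma segment_mvt (f D : R[i] -> R[i]) (x h q : R[i]) (B : R) :
  (forall t : R, 0 <= t <= 1 -> cdiff f (x + t%:C%C * h) (D (x + t%:C%C * h))) ->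
  (forall t : R, 0 <= t <= 1 -> normc (D (x + t%:C%C * h) - q) <= B) ->
  normc (f (x + h) - f x - q * h) <= B * normc h.
Proof.
move=> fD DB.
have [->|h0] := eqVneq h 0; first by rewrite addr0 subrr mulr0 subr0 normc0 mulr0.
have nh : 0 < normc h by rewrite normc_gt0.
apply/ler_addgt0Pr => e e0.
pose F (t : R) := f (x + t%:C%C * h) - q * (t%:C%C * h).
have -> : f (x + h) - f x - q * h = F 1 - F 0.
  by rewrite /F !(mul1r, mul0r, mulr0, addr0, subr0); ring.
apply: lipschitz_local_global => t t01.
have e'0 : 0 < e / normc h by rewrite divr_gt0.
have [r r0 rP] := fD t t01 _ e'0.
exists (r / normc h); first by rewrite divr_gt0.
move=> s _ st.
have Est : x + s%:C%C * h - (x + t%:C%C * h) = (s - t)%:C%C * h.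
  by rewrite rmorphB /=; ring.
have nst : normc ((s - t)%:C%C * h) = `|s - t| * normc h.
  by rewrite normcM normc_real.
have := rP (x + s%:C%C * h); rewrite Est nst -ltr_pdivlMr// => /(_ st).
have -> : e / normc h * (`|s - t| * normc h) = e * `|s - t|.
  by field; rewrite gt_eqF.
set D' := D _ => H.
have -> : F s - F t = (f (x + s%:C%C * h) - f (x + t%:C%C * h) - D' * ((s - t)%:C%C * h))
   + (D' - q) * ((s - t)%:C%C * h) by rewrite /F rmorphB /=; ring.
rewrite (le_trans (normcD _ _))// normcM nst.
have : normc (D' - q) * (`|s - t| * normc h) <= B * (`|s - t| * normc h).
  by rewrite ler_wpM2r ?DB// mulr_ge0 ?normc_ge0.
by move: H; lra.
Qed.

(* Darboux: [phi] attains its maximum over [0, 1], which cannot be at an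
   interior critical point. *)
Lemma derivative_sign_constant (phi d : R -> R) :
  (forall t, 0 <= t <= 1 -> forall e : R, 0 < e -> exists2 r : R, 0 < r &
    forall s, `|s - t| < r ->
      `|phi s - phi t - d t * (s - t)| <= e * `|s - t|) ->
  (forall t, 0 <= t <= 1 -> d t != 0) -> 0 < d 0 -> 0 < d 1.
Proof.
move=> dphi dN0 d0; rewrite ltNge; apply/negP => d1.
have {}d1 : d 1 < 0 by rewrite lt_neqAle d1 dN0//; lra.
have [|c c01 cmax] := @EVT_max R phi 0 1 ler01.
  apply/subspace_continuousP => t; rewrite /= in_itv /= => t01.
  apply/cvgrPdist_le => e e0; have [r r0 rP] := dphi t t01 1 ltr01.
  have K0 : 0 < `|d t| + 1 by rewrite ltr_wpDl.
  apply: (@filterS _ _ _ (fun s => `|s - t| < Num.min r (e / (`|d t| + 1)))).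
    move=> s; rewrite lt_min ltr_pdivlMr// => /andP[/rP H1 H2].
    rewrite distrC -(subrK (d t * (s - t)) (phi s - phi t)).
    rewrite (le_trans (ler_normD _ _))// normrM; lra.
  apply: cvg_within; apply/nbhs_ballP.
  exists (Num.min r (e / (`|d t| + 1))) => /=.
    by rewrite lt_min r0 divr_gt0.
  by move=> s; rewrite /ball /= distrC.
move: c01; rewrite in_itv /= => c01.
have [c_d0|c_d0|c_d0] := ltgtP (d c) 0; last first.
- by move/eqP: c_d0; rewrite (negbTE (dN0 _ c01)).
- have c1 : c < 1 by rewrite lt_neqAle; case/andP: c01 => _ ->; rewrite andbT;
    apply/eqP => cE; move: c_d0 d1; rewrite cE; lra.
  (* With a positive slope at [c], [phi] exceeds its maximum just to the right of [c]; the other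
     case is symmetric. *)
  have [|r r0 rP] := dphi c c01 (d c / 2); first by rewrite divr_gt0.
  pose s := Num.min 1 (c + r / 2).
  have sc : c < s by rewrite lt_min c1 /=; lra.
  have s1 : s <= 1 by rewrite ge_min lexx.
  have sr : s <= c + r / 2 by rewrite ge_min lexx orbT.
  have /rP : `|s - c| < r by rewrite gtr0_norm; lra.
  have : phi s <= phi c by apply: cmax; rewrite in_itv /= s1 andbT; lra.
  by rewrite (gtr0_norm (_ : 0 < s - c)) ?subr_gt0// ler_norml; nra.
- have c1 : 0 < c by rewrite lt_neqAle; case/andP: c01 => -> _; rewrite andbT;
    apply/eqP => cE; move: c_d0 d0; rewrite -cE; lra.
  have [|r r0 rP] := dphi c c01 (- d c / 2); first by lra.
  pose s := Num.max 0 (c - r / 2).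
  have sc : s < c by rewrite gt_max c1 /=; lra.
  have s1 : 0 <= s by rewrite le_max lexx.
  have sr : c - r / 2 <= s by rewrite le_max lexx orbT.
  have /rP : `|s - c| < r by rewrite ltr0_norm; lra.
  have : phi s <= phi c by apply: cmax; rewrite in_itv /= s1 /=; lra.
  by rewrite (ltr0_norm (_ : s - c < 0)) ?subr_lt0// ler_norml; nra.
Qed.

End RealInduction.

(** * Strict differentiability of a primitive of a square root *)

Section StrictDifferentiability.
Context {R : realType}.
Implicit Types (x y k : R[i]).

Lemma normc_conj x : normc (x^*)%C = normc x.
Proof. by case: x => u v /=; rewrite sqrrN. Qed.

Lemma Re_conj_mul_self x : complex.Re (x^*%C * x) = normc x ^+ 2.
Proof.
case: x => u v /=; rewrite sqr_sqrtr ?addr_ge0 ?sqr_ge0//; ring.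
Qed.

Lemma Re_real_mul (r : R) x : complex.Re (r%:C%C * x) = r * complex.Re x.
Proof. by case: x => u v /=; rewrite mul0r subr0. Qed.

Lemma ReD x y : complex.Re (x + y) = complex.Re x + complex.Re y.
Proof. by case: x; case: y. Qed.

Lemma ReB x y : complex.Re (x - y) = complex.Re x - complex.Re y.
Proof. by case: x; case: y. Qed.

Definition open_normc (Omega : set R[i]) := forall x, Omega x ->
  exists2 r : R, 0 < r & forall y, normc (y - x) < r -> Omega y.

Definition continuous_normc (Omega : set R[i]) (f : R[i] -> R[i]) x :=
  forall e : R, 0 < e -> exists2 r : R, 0 < r &
    forall y, Omega y -> normc (y - x) < r -> normc (f y - f x) < e.

(* [D] is one of the two square roots of [Q]; along a segment issued from [k],
   Darboux's property keeps it in the half-plane around [D k]. *)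
Lemma square_root_derivative_continuous (S D Q : R[i] -> R[i])
    (Omega : set R[i]) k :
  open_normc Omega ->
  (forall x, Omega x -> cdiff S x (D x) /\ D x ^+ 2 = Q x) ->
  continuous_normc Omega Q k -> Q k != 0 -> Omega k ->
  continuous_normc Omega D k.
Proof.
move=> oO SD Qk Qk0 Ok e e0.
have D2 := (SD k Ok).2; set q := D k in D2 *.
have q0 : q != 0 by move: Qk0; rewrite -D2 sqrf_eq0.
have n0 : 0 < normc q by rewrite normc_gt0.
set n := normc q in n0.
(* The bound [n ^+ 2 / 2] excludes that [D (p t) - q] and [D (p t) + q] both have modulus at least
   [n]; the bound [e * n] yields the final estimate once [D y + q] has modulus at least [n]. *)
have eta0 : 0 < Num.min (n ^+ 2 / 2) (e * n).
  by rewrite lt_min !(mulr_gt0, exprn_gt0, invr_gt0).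
have [r1 r10 r1P] := Qk _ eta0; have [r2 r20 r2P] := oO k Ok.
exists (Num.min r1 r2) => [|y Oy]; first by rewrite lt_min r10.
rewrite lt_min => /andP[yr1 yr2].
have [->|yk0] := eqVneq y k; first by rewrite subrr normc0.
pose p (t : R) := k + t%:C%C * (y - k).
have pk t : normc (p t - k) = `|t| * normc (y - k).
  by rewrite /p addrC addKr normcM normc_real.
have p_in t : 0 <= t <= 1 -> [/\ Omega (p t), normc (p t - k) < r1 & normc (p t - k) < r2].
  move=> /andP[t0 t1]; have := normc_ge0 (y - k) => yk.
  have H1 : normc (p t - k) < r1 by rewrite pk ger0_norm//; nra.
  have H2 : normc (p t - k) < r2 by rewrite pk ger0_norm//; nra.
  by split=> //; exact: r2P.
have Dp t : 0 <= t <= 1 ->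
    normc (D (p t) - q) * normc (D (p t) + q) < Num.min (n ^+ 2 / 2) (e * n).
  move=> /p_in[Op pr1 pr2]; rewrite -normcM -subr_sqr (SD _ Op).2 D2; exact: r1P.
have far (z : R[i]) : n ^+ 2 <= `|complex.Re (q^*%C * z)| -> n <= normc z.
  move=> H; have := ler_norm_Re (q^*%C * z); rewrite normcM normc_conj -/n => H'.
  by rewrite -(ler_pM2l n0) -expr2; exact: le_trans H'.
have Req t : complex.Re (q^*%C * (D (p t) + q)) = complex.Re (q^*%C * D (p t)) + n ^+ 2.
  by rewrite mulrDr ReD Re_conj_mul_self.
have Rep t : complex.Re (q^*%C * (D (p t) - q)) = complex.Re (q^*%C * D (p t)) - n ^+ 2.
  by rewrite mulrBr ReB Re_conj_mul_self.
have n20 : 0 < n ^+ 2 by rewrite exprn_gt0.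
have ReN0 t : 0 <= t <= 1 -> complex.Re (q^*%C * D (p t)) != 0.
  move=> t01; apply/eqP => Re0.
  have H1 : n <= normc (D (p t) + q) by apply: far; rewrite Req Re0 add0r ger0_norm// ltW.
  have H2 : n <= normc (D (p t) - q).
    by apply: far; rewrite Rep Re0 sub0r normrN ger0_norm// ltW.
  by have := Dp t t01; rewrite lt_min => /andP[+ _]; nra.
have p0 : p 0 = k by rewrite /p mul0r addr0.
have p1 : p 1 = y by rewrite /p mul1r addrC subrK.
have yk2 : 0 < normc (y - k) ^+ 2 by rewrite exprn_gt0// normc_gt0 subr_eq0.
(* The factor conjugate to [y - k] cancels the direction of the segment, so [phi] has derivative
   [d], a positive multiple of the real part of [q^* D (p t)], which never vanishes. *)
pose phi t := complex.Re (q^*%C * (y - k)^*%C * S (p t)).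
pose d t := normc (y - k) ^+ 2 * complex.Re (q^*%C * D (p t)).
have dE t (s : R) : complex.Re (q^*%C * (y - k)^*%C * (D (p t) * (p s - p t))) = d t * (s - t).
  have -> : p s - p t = (s - t)%:C%C * (y - k) by rewrite /p rmorphB /=; ring.
  have -> : q^*%C * (y - k)^*%C * (D (p t) * ((s - t)%:C%C * (y - k))) =
     (s - t)%:C%C * (((y - k)^*%C * (y - k)) * (q^*%C * D (p t))) by ring.
  rewrite Re_real_mul /d.
  have -> : (y - k)^*%C * (y - k) = (normc (y - k) ^+ 2)%:C%C.
    by rewrite mulrC -sqr_normc -normc_norm rmorphXn.
  by rewrite Re_real_mul; ring.
have : 0 < d 1.
  apply: (@derivative_sign_constant R phi) => [t t01 e1 e10|t t01|].
  - have [Op _ _] := p_in t t01.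
    have a0 : 0 < n * normc (y - k) ^+ 2 by rewrite mulr_gt0.
    have [r r0 rP] := (SD _ Op).1 _ (divr_gt0 e10 a0).
    have yk : 0 < normc (y - k) by rewrite normc_gt0 subr_eq0.
    exists (r / normc (y - k)); first by rewrite divr_gt0.
    move=> s; rewrite ltr_pdivlMr// => st.
    have pst : normc (p s - p t) = `|s - t| * normc (y - k).
      have -> : p s - p t = (s - t)%:C%C * (y - k) by rewrite /p rmorphB /=; ring.
      by rewrite normcM normc_real.
    have := rP (p s); rewrite pst => /(_ st) H.
    rewrite -dE /phi -!ReB -!mulrBr (le_trans (ler_norm_Re _))//.
    rewrite normcM normcM !normc_conj -/n.
    rewrite (le_trans (ler_wpM2l _ H)) ?mulr_ge0 ?normc_ge0// le_eqVlt.
    by apply/orP; left; apply/eqP; field; rewrite !gt_eqF.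
  - by rewrite mulf_neq0 ?ReN0// gt_eqF.
  - by rewrite /d p0 Re_conj_mul_self mulr_gt0.
rewrite /d pmulr_rgt0// => ReD0.
have H1 : n <= normc (D (p 1) + q).
  by apply: far; rewrite Req ger0_norm; lra.
have := Dp 1; rewrite ler01 lexx lt_min => /(_ isT)/andP[_].
by rewrite p1 in H1 *; have := normc_ge0 (D y - q); nra.
Qed.

(** Both [x] and [y] vary near [k], which replaces continuity of the derivative in inverse function
    arguments; openness of [Omega] is included. *)
Definition strict_diff (Omega : set R[i]) (S D : R[i] -> R[i]) :=
  forall k, Omega k -> D k != 0 /\ forall e : R, 0 < e ->
    exists2 r : R, 0 < r & forall x, normc (x - k) < r -> Omega x /\
      forall y, normc (y - k) < r ->
        normc (S y - S x - D k * (y - x)) <= e * normc (y - x).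

Lemma square_root_primitive_strict_diff (S D Q : R[i] -> R[i])
    (Omega : set R[i]) :
  open_normc Omega ->
  (forall x, Omega x -> cdiff S x (D x) /\ D x ^+ 2 = Q x) ->
  (forall x, Omega x -> continuous_normc Omega Q x /\ Q x != 0) ->
  strict_diff Omega S D.
Proof.
move=> oO SD HQ k Ok; have [cQ Q0] := HQ k Ok.
split; first by move: Q0; rewrite -(SD k Ok).2 sqrf_eq0.
move=> e e0.
have [r1 r10 r1P] := square_root_derivative_continuous oO SD cQ Q0 Ok e0.
have [r2 r20 r2P] := oO k Ok.
exists (Num.min r1 r2) => [|x]; first by rewrite lt_min r10.
rewrite lt_min => /andP[xr1 xr2]; split=> [|y]; first exact: r2P.
rewrite lt_min => /andP[yr1 yr2].
(* The segment from [x] to [y] stays in the disc where [D] is [e]-close to [D k], so the mean value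
   inequality applies with [q = D k]. *)
have seg (t : R) : 0 <= t <= 1 ->
    normc (x + t%:C%C * (y - x) - k) < r1 /\ normc (x + t%:C%C * (y - x) - k) < r2.
  move=> /andP[t0 t1].
  suff : normc (x + t%:C%C * (y - x) - k) <= (1 - t) * normc (x - k) + t * normc (y - k).
    have : (1 - t) * normc (x - k) + t * normc (y - k) <=
           Num.max (normc (x - k)) (normc (y - k)) by case: (leP (normc (x - k)) (normc (y - k))); nra.
    by move=> H1 /le_trans/(_ H1) H2; split; rewrite (le_lt_trans H2)// gt_max; apply/andP.
  have -> : x + t%:C%C * (y - x) - k = (1 - t)%:C%C * (x - k) + t%:C%C * (y - k).
    by rewrite rmorphB /=; ring.
  by rewrite (le_trans (normcD _ _))// !normcM !normc_real !ger0_norm//; lra.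
rewrite -[in S y](subrKC x y).
apply: (segment_mvt (D := D)) => t /seg[tr1 tr2].
  exact: (SD _ (r2P _ tr2)).1.
by apply/ltW/r1P => //; exact: r2P.
Qed.

End StrictDifferentiability.

(** * Local inverses, and uniqueness and growth of lifts *)

Section Lifts.
Context {R : realType}.
Variables (Omega : set R[i]) (S D : R[i] -> R[i]).
Hypothesis SD : strict_diff Omega S D.
Implicit Types (x y k u v w z : R[i]) (U : set R[i]).

Lemma locally_expanding k : Omega k -> 0 < normc (D k) /\
  exists2 r : R, 0 < r & forall x, normc (x - k) < r -> Omega x /\
    forall y, normc (y - k) < r ->
      normc (D k) / 2 * normc (y - x) <= normc (S y - S x).
Proof.
move=> Ok; have [D0 HS] := SD Ok; have n0 : 0 < normc (D k) by rewrite normc_gt0.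
split=> //; have [|r r0 rP] := HS (normc (D k) / 2); first by rewrite divr_gt0.
exists r => // x /rP[Ox Hx]; split=> // y /Hx.
have := ler_normcB (D k * (y - x)) (S y - S x).
by rewrite (normcB (D k * _)) normcM; lra.
Qed.

Lemma locally_injective k : Omega k -> exists2 r : R, 0 < r &
  forall x y, normc (x - k) < r -> normc (y - k) < r -> S x = S y -> x = y.
Proof.
case/locally_expanding => n0 [r r0 rP]; exists r => // x y /rP[_ H] /H + Sxy.
rewrite Sxy subrr normc0 pmulr_rle0; last by rewrite divr_gt0.
move=> H'; apply/eqP; rewrite -subr_eq0 -normc_eq0 normcB.
by rewrite eq_le H' normc_ge0.
Qed.

Lemma strict_diff_continuous k : Omega k -> continuous_normc setT S k.
Proof.
move=> Ok e e0; have [_ HS] := SD Ok; have [r r0 rP] := HS 1 ltr01.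
have K0 : 0 < normc (D k) + 1 by rewrite ltr_wpDl ?normc_ge0.
exists (Num.min r (e / (normc (D k) + 1))); first by rewrite lt_min r0 divr_gt0.
move=> y _; rewrite lt_min ltr_pdivlMr// => /andP[yr ye].
have [|_ /(_ _ yr)] := rP k; first by rewrite subrr normc0.
have := normcD (S y - S k - D k * (y - k)) (D k * (y - k)).
rewrite subrK normcM; lra.
Qed.

(** A continuous lift of [p] through [S] over [U]; with [p = id] it is a section of [S]. *)
Definition lift U (p f : R[i] -> R[i]) := forall u, U u ->
  [/\ Omega (f u), S (f u) = p u & continuous_normc U f u].

Definition discN z (r : R) : set R[i] := [set w | normc (w - z) < r].

(* Newton steps with the fixed slope [D k] halve [|S x - w|], which compactness
   bounds below when [w] is not attained. *)
Lemma locally_solvable k (r : R) w :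
  0 < r -> 0 < normc (D k) ->
  (forall x, normc (x - k) < r -> Omega x) ->
  (forall x y, normc (x - k) < r -> normc (y - k) < r ->
     normc (S y - S x - D k * (y - x)) <= normc (D k) / 2 * normc (y - x)) ->
  forall k', normc (k' - k) < r / 2 ->
  normc (w - S k') < normc (D k) * r / 32 ->
  exists2 x, normc (x - k) < r & S x = w.
Proof.
set n := normc (D k) => r0 n0 Or HS k' k'r wk'.
have D0 : D k != 0 by rewrite -normc_gt0.
apply: contrapT => noroot.
have box_r x : `|complex.Re (x - k')| <= r / 4 -> `|complex.Im (x - k')| <= r / 4 ->
    normc (x - k) < r.
  move=> H1 H2; have := normc_triangle k' x k; have := normc_le_ReIm (x - k'); lra.
(* As [w] is assumed not attained, the distance from [S x] to [w] has a positive lower bound [d] on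
   the square. *)
have [|x xR xI|d d0 dP] := @box_unif R (fun d x => d <= normc (S x - w)) k' (r / 4).
- by move=> s t x _; exact: le_trans.
- have xr := box_r x xR xI; have Sx0 : 0 < normc (S x - w).
    by rewrite normc_gt0 subr_eq0; apply/eqP => Sx; apply: noroot; exists x.
  have [|e e0 eP] := strict_diff_continuous (Or x xr) (e := normc (S x - w) / 2).
    by rewrite divr_gt0.
  exists e, (normc (S x - w) / 2); split => //; first by rewrite divr_gt0.
  move=> y /(eP _ I); have := normc_triangle (S y) (S x) w.
  by rewrite (normcB (S x) (S y)); lra.
set d0' := normc (S k' - w).
have iter m : exists x, [/\ `|complex.Re (x - k')| <= r / 4,
    `|complex.Im (x - k')| <= r / 4 & normc (S x - w) <= d0' / 2 ^+ m].
  elim: m => [|m [x [xR xI xm]]].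
    by exists k'; rewrite subrr /= normr0 expr0 divr1 lexx !divr_ge0// ltW.
  have xr := box_r x xR xI.
  have k'rr : normc (k' - k) < r by lra.
  have xm0 : normc (S x - w) <= d0'.
    by rewrite (le_trans xm)// ler_pdivrMr ?exprn_gt0// ler_peMr ?normc_ge0// exprn_ege1// ler1n.
  pose x' := x - (S x - w) / D k.
  have x'x : x' - x = - ((S x - w) / D k) by rewrite /x' addrAC subrr add0r.
  have nx'x : normc (x' - x) * n = normc (S x - w).
    by rewrite x'x normcN normcM normcV -/n divfK// gt_eqF.
  (* The constant 32 enters here: expansion puts [x] within [r / 8] of [k'], and the Newton step is
     shorter than [r / 32]. *)
  have x'k' : normc (x' - k') < r / 4.
    have := HS _ _ k'rr xr; have := ler_normcB (D k * (x - k')) (S x - S k').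
    rewrite (normcB (D k * _)) normcM -/n.
    have := normc_triangle w (S x) (S k'); rewrite (normcB w (S k')) in wk' *.
    have := normc_triangle x x' k'; rewrite -/d0' in wk' *.
    by rewrite -2!(ltr_pM2r n0); nra.
  exists x'; split.
  - by rewrite (le_trans (ler_norm_Re _))// ltW.
  - by rewrite (le_trans (ler_norm_Im _))// ltW.
  - have x'r : normc (x' - k) < r by have := normc_triangle k' x' k; lra.
    have := HS _ _ xr x'r; rewrite -/n.
    have -> : S x' - S x - D k * (x' - x) = S x' - w by rewrite x'x; field.
    rewrite exprSr invfM mulrA; move: nx'x xm; nra.
(* This many halvings bring the distance below [d], a contradiction. *)
pose m := Num.bound (d0' / d).
have [x [xR xI]] := iter m; have := dP x xR xI => /le_trans/[apply].
rewrite leNgt ltr_pdivrMr ?exprn_gt0// mulrC -ltr_pdivrMr//.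
by rewrite upper_nthrootP.
Qed.

(** The radius [d] is common to all base points [k'] near [k], as the later compactness argument
    requires. *)
Lemma local_sections k : Omega k -> exists e d : R, [/\ 0 < e, 0 < d &
  forall k', normc (k' - k) < e ->
    exists g, g (S k') = k' /\ lift (discN (S k') d) id g].
Proof.
move=> Ok; have [n0 [r1 r10 r1P]] := locally_expanding Ok.
have [_ HS] := SD Ok; have [|r2 r20 r2P] := HS (normc (D k) / 2).
  by rewrite divr_gt0.
pose r := Num.min r1 r2; have r0 : 0 < r by rewrite lt_min r10.
exists (r / 2), (normc (D k) * r / 32); split; rewrite ?divr_gt0 ?mulr_gt0//.
move=> k' k'r.
have inr x : normc (x - k) < r -> normc (x - k) < r1 /\ normc (x - k) < r2.
  by rewrite lt_min => /andP.
have sol w : exists x, discN (S k') (normc (D k) * r / 32) w ->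
    normc (x - k) < r /\ S x = w.
  (* The value 0 outside the disc only serves to make the choice function total. *)
  have [wd|] := pselect (discN (S k') (normc (D k) * r / 32) w); last by exists 0.
  have [||x xr Sx] := @locally_solvable k r w r0 n0 _ _ k' k'r wd.
  - by move=> x /inr[/r1P[]].
  - by move=> x y /inr[_ /r2P[_ H]] /inr[_ /H].
  - by exists x.
have [g gP] := choice sol; exists g; split.
  have [|gr Sg] := gP (S k'); first by rewrite /discN /= subrr normc0 divr_gt0 ?mulr_gt0.
  have k'rr : normc (k' - k) < r by lra.
  have [_ /(_ _ (inr _ k'rr).1)] := r1P _ (inr _ gr).1.
  rewrite Sg subrr normc0 pmulr_rle0 ?divr_gt0// => H.
  by apply/esym/eqP; rewrite -subr_eq0 -normc_eq0 eq_le H normc_ge0.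
move=> u uU; have [ur Su] := gP u uU; split=> //; first by have [] := r1P _ (inr _ ur).1.
move=> e e0; exists (e * (normc (D k) / 2)); first by rewrite mulr_gt0 ?divr_gt0.
move=> v vU; have [vr Sv] := gP v vU.
have [_ /(_ _ (inr _ vr).1)] := r1P _ (inr _ ur).1; rewrite Su Sv => H.
by rewrite -(ltr_pdivrMr _ _ (divr_gt0 n0 _)) // => H'; rewrite (le_lt_trans _ H')// ler_pdivlMr ?divr_gt0// mulrC.
Qed.

Definition path_continuous (c : R -> R[i]) := forall t : R, 0 <= t <= 1 ->
  forall e : R, 0 < e -> exists2 r : R, 0 < r &
    forall s, 0 <= s <= 1 -> `|s - t| < r -> normc (c s - c t) < e.

(** Agreement propagates to the right by local injectivity of [S] and to limits from the left by
    continuity. *)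
Lemma path_lift_unique (c1 c2 : R -> R[i]) :
  path_continuous c1 -> path_continuous c2 ->
  (forall t, 0 <= t <= 1 -> Omega (c1 t) /\ S (c1 t) = S (c2 t)) ->
  c1 0 = c2 0 -> c1 1 = c2 1.
Proof.
move=> C1 C2 OS c0.
suff H t : 0 <= t <= 1 -> c1 t = c2 t by apply: H; lra.
apply: (@real_induction R (fun t => c1 t = c2 t)) => {t} // t t01.
  move=> ct; have t01' : 0 <= t <= 1 by lra.
  have [r r0 rP] := locally_injective (OS t t01').1.
  have [r1 r10 r1P] := C1 t t01' r r0; have [r2 r20 r2P] := C2 t t01' r r0.
  exists (Num.min r1 r2) => [|s /andP[ts]]; first by rewrite lt_min r10.
  rewrite -ltrBlDl lt_min => /andP[sr1 sr2] s1.
  have s01 : 0 <= s <= 1 by lra.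
  apply: rP; last exact: (OS s s01).2.
  - by apply: r1P => //; rewrite gtr0_norm ?subr_gt0.
  - by rewrite ct; apply: r2P => //; rewrite gtr0_norm ?subr_gt0.
move=> Heq; have t01' : 0 <= t <= 1 by lra.
apply/eqP; rewrite -subr_eq0 -normc_eq0 eq_le normc_ge0 andbT leNgt; apply/negP => d0.
have d20 : 0 < normc (c1 t - c2 t) / 2 by rewrite divr_gt0.
have [r1 r10 r1P] := C1 t t01' _ d20; have [r2 r20 r2P] := C2 t t01' _ d20.
pose s := Num.max 0 (t - Num.min r1 r2 / 2).
have m0 : 0 < Num.min r1 r2 by rewrite lt_min r10.
have m1 : Num.min r1 r2 <= r1 by rewrite ge_min lexx.
have m2 : Num.min r1 r2 <= r2 by rewrite ge_min lexx orbT.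
have s0 : 0 <= s by rewrite le_max lexx.
have st : s < t by rewrite gt_max; lra.
have sr : t - Num.min r1 r2 / 2 <= s by rewrite le_max lexx orbT.
have s01 : 0 <= s <= 1 by lra.
have str1 : `|s - t| < r1 by rewrite ltr0_norm ?subr_lt0//; lra.
have str2 : `|s - t| < r2 by rewrite ltr0_norm ?subr_lt0//; lra.
have := r1P s s01 str1; have := r2P s s01 str2; rewrite -Heq ?s0//.
by have := normc_triangle (c1 s) (c1 t) (c2 t); rewrite (normcB (c1 t) (c1 s)); lra.
Qed.

Definition convexC U := forall u v, U u -> U v -> forall t : R, 0 <= t <= 1 ->
  U (u + t%:C%C * (v - u)).

Lemma lift_path_continuous U p f u v : convexC U -> lift U p f -> U u -> U v ->
  path_continuous (fun t => f (u + t%:C%C * (v - u))).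
Proof.
move=> cU fU Uu Uv t t01 e e0.
have [_ _ /(_ e e0)[r r0 rP]] := fU _ (cU u v Uu Uv t t01).
(* Adding 1 covers the degenerate segment [u = v]. *)
have K0 : 0 < normc (v - u) + 1 by rewrite ltr_wpDl ?normc_ge0.
exists (r / (normc (v - u) + 1)); first by rewrite divr_gt0.
move=> s s01; rewrite ltr_pdivlMr// => st; apply: rP; first exact: cU.
have -> : u + s%:C%C * (v - u) - (u + t%:C%C * (v - u)) = (s - t)%:C%C * (v - u).
  by rewrite rmorphB /=; ring.
by rewrite normcM normc_real; have := normr_ge0 (s - t); nra.
Qed.

(** Restriction to the segment from [u] to [v] reduces this to uniqueness of path lifts. *)
Lemma lift_unique U p f1 f2 u v : convexC U -> lift U p f1 -> lift U p f2 ->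
  U u -> U v -> f1 u = f2 u -> f1 v = f2 v.
Proof.
move=> cU l1 l2 Uu Uv fu.
have pu : u + (0 : R)%:C%C * (v - u) = u by rewrite mul0r addr0.
have pv : u + (1 : R)%:C%C * (v - u) = v by rewrite mul1r subrKC.
have := @path_lift_unique (fun t => f1 (u + t%:C%C * (v - u)))
  (fun t => f2 (u + t%:C%C * (v - u))); rewrite pu pv; apply => //.
- exact: lift_path_continuous l1 Uu Uv.
- exact: lift_path_continuous l2 Uu Uv.
- move=> t t01; have Ut := cU u v Uu Uv t t01.
  by have [? S1 _] := l1 _ Ut; have [_ S2 _] := l2 _ Ut; rewrite S1 S2.
Qed.

(* Where [R0 <= |x|] the lifted path moves at most twice as fast as its image. *)
Lemma path_lift_bounded (c : R -> R[i]) z h (R0 : R) :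
  (forall x, Omega x -> R0 <= normc x -> 1 <= normc (D x)) ->
  path_continuous c ->
  (forall t, 0 <= t <= 1 -> Omega (c t) /\ S (c t) = z + t%:C%C * h) ->
  normc (c 1) <= Num.max R0 (normc (c 0)) + 2 * normc h.
Proof.
move=> Dge1 cc Oc; set A := Num.max _ _.
have A1 : R0 <= A by rewrite le_max lexx.
have A2 : normc (c 0) <= A by rewrite le_max lexx orbT.
have h0 := normc_ge0 h.
suff H t : 0 <= t <= 1 -> normc (c t) <= A + 2 * t * normc h.
  by rewrite -[2]mulr1; apply: H; lra.
apply: (@real_induction R (fun t => normc (c t) <= A + 2 * t * normc h)) => {t}.
- by rewrite mulr0 mul0r addr0.
- move=> t t01 Pt; have t01' : 0 <= t <= 1 by lra.
  have [Ot St] := Oc t t01'.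
  (* Below [R0] continuity alone keeps the path under the bound; beyond it, strict differentiability
     with error 1/2 gives speed at most [2 * normc h]. *)
  have [ctR|ctR] := ltP (normc (c t)) R0.
    have [|r r0 rP] := cc t t01' (R0 - normc (c t)); first by rewrite subr_gt0.
    exists r => // s /andP[ts sr] s1; have s01 : 0 <= s <= 1 by lra.
    have := rP s s01; rewrite gtr0_norm ?subr_gt0// => /(_ ltac:(lra)).
    by have := ler_normcB (c s) (c t); nra.
  have D1 := Dge1 _ Ot ctR.
  have [_ HS] := SD Ot; have [|r r0 rP] := HS (1 / 2); first by lra.
  have [r' r'0 r'P] := cc t t01' _ r0.
  exists r' => // s /andP[ts sr] s1; have s01 : 0 <= s <= 1 by lra.
  have := r'P s s01; rewrite gtr0_norm ?subr_gt0// => /(_ ltac:(lra)) cst.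
  have [|_ /(_ _ cst)] := rP (c t); first by rewrite subrr normc0.
  have -> : S (c s) - S (c t) = (s - t)%:C%C * h.
    by rewrite (Oc s s01).2 St rmorphB /=; ring.
  have := ler_normcB (D (c t) * (c s - c t)) ((s - t)%:C%C * h).
  rewrite (normcB (D _ * _)) !normcM normc_real gtr0_norm ?subr_gt0//.
  have := ler_normcB (c s) (c t); have := normc_ge0 (c s - c t).
  by nra.
- move=> t t01 Pt; have t01' : 0 <= t <= 1 by lra.
  rewrite leNgt; apply/negP => ct.
  have [|r r0 rP] := cc t t01' (normc (c t) - (A + 2 * t * normc h)).
    by rewrite subr_gt0.
  pose s := Num.max 0 (t - r / 2).
  have s0 : 0 <= s by rewrite le_max lexx.
  have st : s < t by rewrite gt_max; lra.
  have sr : t - r / 2 <= s by rewrite le_max lexx orbT.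
  have s01 : 0 <= s <= 1 by lra.
  have := rP s s01; rewrite ltr0_norm ?subr_lt0// => /(_ ltac:(lra)).
  have := Pt s; rewrite s0 st => /(_ isT).
  by rewrite normcB; have := ler_normcB (c t) (c s); nra.
Qed.

(** Derivative of the inverse function: the tolerance [e * n ^+ 2 / 2] loses a factor [2 / n] by
    local expansion and another [1 / n] on dividing by [D (g z)], leaving [e]. *)
Lemma section_cdiff (g : R[i] -> R[i]) (z : R[i]) (r : R) :
  0 < r -> lift (discN z r) id g -> cdiff g z (D (g z))^-1.
Proof.
move=> r0 lg e e0; have [|Og Sg cg] := lg z; first by rewrite /discN /= subrr normc0.
have [n0 [r1 r10 r1P]] := locally_expanding Og.
set n := normc (D (g z)) in n0 r1P.
have [D0 HS] := SD Og; have [|r2 r20 r2P] := HS (e * n ^+ 2 / 2).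
  by rewrite divr_gt0 ?mulr_gt0 ?exprn_gt0.
have [|r3 r30 r3P] := cg (Num.min r1 r2); first by rewrite lt_min r10.
exists (Num.min r r3) => [|y]; first by rewrite lt_min r0.
rewrite lt_min => /andP[yr yr3]; have [_ Sy _] := lg y yr.
have := r3P y yr yr3; rewrite lt_min => /andP[yr1 yr2].
have [|_ /(_ _ yr1)] := r1P (g z); first by rewrite subrr normc0.
have [|_ /(_ _ yr2)] := r2P (g z); first by rewrite subrr normc0.
rewrite Sy Sg /= => H1 H2.
have -> : g y - g z - (D (g z))^-1 * (y - z) =
   - (y - z - D (g z) * (g y - g z)) / D (g z) by field.
rewrite normcM normcN normcV -/n ler_pdivrMr//.
rewrite (le_trans H1)// -(ler_pM2l (ltr0n R 2)).
have : e * n * (n / 2 * normc (g y - g z)) <= e * n * normc (y - z).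
  by rewrite ler_wpM2l// mulr_ge0 ?ltW.
by rewrite -/n; lra.
Qed.

End Lifts.

(** * Continuation of local inverses to the upper half-plane *)

Section GlobalInverse.
Context {R : realType}.
Variables (Omega : set R[i]) (S D : R[i] -> R[i]).
Hypothesis SD : strict_diff Omega S D.
Hypothesis S_boundary : forall x, ~ Omega x -> forall c : R, 0 < c ->
  exists2 e : R, 0 < e &
    forall y, Omega y -> normc (y - x) < e -> complex.Im (S y) < c.
Implicit Types (x y k u v w z : R[i]) (U : set R[i]).

Lemma continuous_normc_sub U U' f u : U' `<=` U ->
  @continuous_normc R U f u -> continuous_normc U' f u.
Proof. by move=> UU' fu e /fu[r r0 rP]; exists r => // y /UU'; exact: rP. Qed.

Lemma lift_sub U U' p f : U' `<=` U -> lift Omega S U p f -> lift Omega S U' p f.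
Proof.
move=> UU' fU u /[dup] U'u /UU'/fU[Of Sf cf]; split=> //.
exact: continuous_normc_sub cf.
Qed.

Lemma convexC_disc z (r : R) : convexC (discN z r).
Proof.
move=> u v ur vr t /andP[t0 t1]; rewrite /discN /= in ur vr *.
have -> : u + t%:C%C * (v - u) - z = (1 - t)%:C%C * (u - z) + t%:C%C * (v - z).
  by rewrite rmorphB /=; ring.
rewrite (le_lt_trans (normcD _ _))// !normcM !normc_real !ger0_norm ?subr_ge0//.
have [->|t0'] := eqVneq t 0; first by rewrite subr0 mul1r mul0r addr0.
have {t0'}tgt0 : 0 < t by rewrite lt_neqAle eq_sym t0' t0.
by nra.
Qed.

Lemma convexC_setI U U' : @convexC R U -> convexC U' -> convexC (U `&` U').
Proof. by move=> cU cU' u v [? ?] [? ?] t t01; split; [exact: cU | exact: cU']. Qed.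

(** Compactness of a square: near a point of [Omega] local sections have a common radius, and near
    any other point the condition on [Im (S x)] fails throughout [Omega]. *)
Lemma uniform_sections (M c : R) : 0 < c -> exists2 d : R, 0 < d &
  forall x, Omega x -> normc x <= M -> c <= complex.Im (S x) ->
    exists g, g (S x) = x /\ lift Omega S (discN (S x) d) id g.
Proof.
move=> c0; pose P (d : R) x := Omega x -> c <= complex.Im (S x) ->
    exists g, g (S x) = x /\ lift Omega S (discN (S x) d) id g.
have [| |d d0 dP] := @box_unif R P 0 M.
- move=> s t x s0 st Px Ox cx; have [g [gS gl]] := Px Ox cx; exists g; split=> //.
  by apply: lift_sub gl => w; rewrite /discN /= => /lt_le_trans; apply.
- move=> x _ _; have [Ox|nOx] := pselect (Omega x).
    have [e [d [e0 d0 edP]]] := local_sections SD Ox.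
    by exists e, d; split=> // y /edP Py _ _.
  have [e e0 eP] := S_boundary nOx c0; exists e, 1; split=> // y yx Oy.
  by rewrite leNgt (eP y Oy yx).
exists d => // x Ox xM cx; apply: dP => //; rewrite subr0.
  exact: le_trans (ler_norm_Re x) xM.
exact: le_trans (ler_norm_Im x) xM.
Qed.

Variable R0 : R.
Hypothesis D_ge1 : forall x, Omega x -> R0 <= normc x -> 1 <= normc (D x).
Variable x0 : R[i].
Hypothesis Ox0 : Omega x0.

Definition homothety z (s : R) u := z + s%:C%C * (u - z).

Lemma homothety_dist z s u v :
  normc (homothety z s u - homothety z s v) = `|s| * normc (u - v).
Proof.
rewrite /homothety.
have -> : z + s%:C%C * (u - z) - (z + s%:C%C * (v - z)) = s%:C%C * (u - v) by ring.
by rewrite normcM normc_real.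
Qed.

(* The lift at scale [t] follows, from each [f u], the local section of [S] at
   [f u]; local injectivity makes these choices locally constant. *)
Lemma lift_continuation U (L d s t : R) f :
  convexC U -> U (S x0) -> (forall u, U u -> normc (u - S x0) <= L) ->
  0 <= s <= t -> t <= 1 -> (t - s) * L <= d / 2 -> 0 < d ->
  (forall u, U u -> exists g, g (S (f u)) = f u /\
     lift Omega S (discN (S (f u)) d) id g) ->
  f (S x0) = x0 -> lift Omega S U (homothety (S x0) s) f ->
  exists f', f' (S x0) = x0 /\ lift Omega S U (homothety (S x0) t) f'.
Proof.
set z0 := S x0 => cU Uz0 UL /andP[s0 st] t1 stL d0 secs fz0 lf.
have /choice[G GP] u : exists g, U u -> g (S (f u)) = f u /\
     lift Omega S (discN (S (f u)) d) id g.
  by have [/secs[g gP]|nUu] := pselect (U u); [exists g | exists id].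
have pz0 r : homothety z0 r z0 = z0 by rewrite /homothety subrr mulr0 addr0.
have t0 : 0 <= t by lra.
have pst u : U u -> normc (homothety z0 t u - homothety z0 s u) <= d / 2.
  move=> /UL uL; rewrite /homothety.
  have -> : z0 + t%:C%C * (u - z0) - (z0 + s%:C%C * (u - z0)) = (t - s)%:C%C * (u - z0).
    by rewrite rmorphB /=; ring.
  rewrite normcM normc_real ger0_norm ?subr_ge0// (le_trans _ stL)//.
  by rewrite ler_wpM2l ?subr_ge0.
(* Each new value uses the section [G u] attached to the old value [f u]; continuity must compare
   [G u] with [G v] for [v] near [u]. *)
exists (fun u => G u (homothety z0 t u)); split.
  have [_ Sf _] := lf _ Uz0; have [GS _] := GP _ Uz0.
  by move: GS; rewrite Sf fz0 !pz0.
move=> u Uu; have [Of Sf cf] := lf u Uu; have [Gu lG] := GP u Uu.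
have ptu : discN (S (f u)) d (homothety z0 t u).
  by rewrite /discN /= Sf; have := pst u Uu; lra.
have [Og Sg cg] := lG _ ptu; split=> // e e0.
have [ri ri0 riP] := locally_injective SD Of.
have psu : discN (S (f u)) d (homothety z0 s u).
  by rewrite /discN /= Sf subrr normc0.
have [_ _ cg0] := lG _ psu.
have [r1 r10 r1P] := cg0 _ ri0; have [r2 r20 r2P] := cf _ ri0.
have [r3 r30 r3P] := cg _ e0.
exists (Num.min (Num.min r1 r2) (Num.min r3 (d / 2))).
  by rewrite !lt_min r10 r20 r30 divr_gt0.
move=> v Uv; rewrite !lt_min => /andP[/andP[vr1 vr2] /andP[vr3 vd]].
have hom_le (q : R) : 0 <= q <= 1 ->
    normc (homothety z0 q v - homothety z0 q u) <= normc (v - u).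
  move=> /andP[q0 q1]; rewrite homothety_dist ger0_norm//.
  by rewrite ler_piMl// normc_ge0.
have hs : normc (homothety z0 s v - homothety z0 s u) <= normc (v - u).
  by apply: hom_le; lra.
have ht : normc (homothety z0 t v - homothety z0 t u) <= normc (v - u).
  by apply: hom_le; lra.
have [Ofv Sfv _] := lf v Uv; have [Gv lGv] := GP v Uv.
have psv : discN (S (f u)) d (homothety z0 s v) by rewrite /discN /= Sf; lra.
have ptv : discN (S (f u)) d (homothety z0 t v).
  rewrite /discN /= Sf.
  have := normc_triangle (homothety z0 t u) (homothety z0 t v) (homothety z0 s u).
  by have := pst u Uu; lra.
(* Both sides lie in the disc about [f u] where [S] is injective and have the same image. *)
have Gufv : G u (homothety z0 s v) = f v.
  have [_ SGv _] := lG _ psv; apply: riP; last by rewrite SGv.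
    have := r1P _ psv (le_lt_trans hs vr1).
    by rewrite -[in X in X < _ -> _]Sf Gu.
  exact: r2P.
suff <- : G u (homothety z0 t v) = G v (homothety z0 t v).
  by apply: r3P => //; exact: le_lt_trans ht vr3.
(* The two sections agree at the old point [homothety z0 s v], hence on the convex intersection of
   their discs. *)
apply: (@lift_unique _ _ _ _ SD (discN (S (f u)) d `&` discN (S (f v)) d) id
  (G u) (G v) (homothety z0 s v)).
- by apply: convexC_setI; exact: convexC_disc.
- by apply: lift_sub lG => w [].
- by apply: lift_sub lGv => w [].
- by split=> //; rewrite /discN /= Sfv subrr normc0.
- split=> //; rewrite /discN /= Sfv; have := pst v Uv; lra.
- by rewrite Gufv -Sfv Gv.
Qed.

Lemma convex_section U (L c : R) : 0 < c ->
  convexC U -> U (S x0) ->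
  (forall u, U u -> normc (u - S x0) <= L) ->
  (forall u, U u -> c <= complex.Im u) ->
  exists f, f (S x0) = x0 /\ lift Omega S U id f.
Proof.
set z0 := S x0 => c0 cU Uz0; wlog L0 : L / 0 < L => [wlg UL|UL Uc].
  apply: (wlg (Num.max L 1)) => [|u /UL uL]; first by rewrite lt_max ltr01 orbT.
  by rewrite le_max uL.
(* This bounds the endpoint of any lift, starting at [x0], of a segment of length at most [L]. *)
pose M := Num.max R0 (normc x0) + 2 * L.
have [d d0 dP] := uniform_sections M c0.
suff H m (s : R) : 0 <= s <= 1 -> s * L <= m%:R * (d / 2) ->
    (* Induction on the number of dilation steps, each moving points of [U] by at most [d / 2]; at
       scale 0 the lift is constantly [x0]. *)
    exists f, f z0 = x0 /\ lift Omega S U (homothety z0 s) f.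
  have [||f [fz0 lf]] := H (Num.bound (L / (d / 2))) 1.
  - by lra.
  - rewrite mul1r -ler_pdivrMr ?divr_gt0//; apply/ltW/archi_boundP.
    by rewrite !divr_ge0// ltW.
  exists f; split=> // u /lf[Of Sf cf]; split=> //.
  by rewrite Sf /homothety mul1r subrKC.
elim: m s => [|m IH] s /andP[s0 s1] sm.
  have -> : s = 0 by nra.
  exists (fun=> x0); split=> // u Uu; split=> //.
    by rewrite /homothety mul0r addr0.
  by move=> e e0; exists 1 => // y _ _; rewrite subrr normc0.
pose s' := Num.max 0 (s - d / 2 / L).
have s'0 : 0 <= s' by rewrite le_max lexx.
have dL0 : 0 < d / 2 / L by rewrite !divr_gt0.
have s's : s' <= s by rewrite ge_max s0 /=; lra.
have dL : d / 2 / L * L = d / 2 by rewrite divfK// gt_eqF.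
have ss' : (s - s') * L <= d / 2.
  by rewrite -dL ler_pM2r// lerBlDl -lerBlDr le_max lexx orbT.
have s'm : s' * L <= m%:R * (d / 2).
  rewrite /s'; case: (leP 0 (s - d / 2 / L)) => _; last by rewrite mul0r mulr_ge0// ltW// divr_gt0.
  by rewrite mulrBl dL; move: sm; rewrite -natr1; lra.
have [|f [fz0 lf]] := IH s' _ s'm; first by lra.
apply: (@lift_continuation U L d s' s f) => //; first by rewrite s'0.
move=> u Uu; have [Of Sf _] := lf u Uu; apply: dP => //.
(* [f u] is the end of a lift of the segment from [z0] to [homothety z0 s' u], so its modulus is at
   most [M]. *)
- have /(_ R0 D_ge1) := @path_lift_bounded _ _ _ _ SD
    (fun t => f (z0 + t%:C%C * (u - z0))) z0 (s'%:C%C * (u - z0)).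
  rewrite mul0r addr0 mul1r subrKC fz0 => /(_ _ _)/le_trans; apply.
  + exact: (lift_path_continuous cU lf Uz0 Uu).
  + move=> t t01; have [Ot St _] := lf _ (cU _ _ Uz0 Uu t t01).
    by split=> //; rewrite St /homothety; ring.
  + rewrite normcM normc_real ger0_norm// lerD2l ler_pM2l//.
    by rewrite (le_trans _ (UL u Uu))// ler_piMl ?normc_ge0//; lra.
- by rewrite Sf; apply: Uc; apply: cU => //; lra.
Qed.

Lemma ImD x y : complex.Im (x + y) = complex.Im x + complex.Im y.
Proof. by case: x; case: y. Qed.

Lemma ImB x y : complex.Im (x - y) = complex.Im x - complex.Im y.
Proof. by case: x; case: y. Qed.

Lemma Im_real_mul (r : R) x : complex.Im (r%:C%C * x) = r * complex.Im x.
Proof. by case: x => u v /=; rewrite mul0r addr0. Qed.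

Lemma convexC_Im_gt (c : R) : convexC [set z | c < complex.Im z].
Proof.
move=> u v /= uc vc t /andP[t0 t1]; rewrite ImD Im_real_mul ImB.
have [->|t0'] := eqVneq t 0; first by rewrite mul0r addr0.
have {t0'}tgt0 : 0 < t by rewrite lt_neqAle eq_sym t0' t0.
by nra.
Qed.

Lemma half_plane_section : 0 < complex.Im (S x0) ->
  exists g, g (S x0) = x0 /\ lift Omega S [set z | 0 < complex.Im z] id g.
Proof.
set z0 := S x0 => Im0.
(* Convex sets exhausting the half-plane; the shift by 2 makes the quotient strictly less than
   [Im z0], so [z0] lies in all of them. *)
pose U (n : nat) := discN z0 n.+2%:R `&` [set z | complex.Im z0 / n.+2%:R < complex.Im z].
have Uz0 n : U n z0.
  split; first by rewrite /discN /= subrr normc0 ltr0n.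
  by rewrite /= ltr_pdivrMr ?ltr0n// ltr_pMr// ltr1n.
have cU n : convexC (U n).
  by apply: convexC_setI; [exact: convexC_disc | exact: convexC_Im_gt].
have /choice[f fP] n : exists f, f z0 = x0 /\ lift Omega S (U n) id f.
  apply: (@convex_section (U n) n.+2%:R (complex.Im z0 / n.+2%:R)) => //.
  - by rewrite divr_gt0 ?ltr0n.
  - by move=> u [/ltW].
  - by move=> u [_ /ltW].
have /choice[N NP] w : exists n, 0 < complex.Im w -> U n w.
  have [w0|] := pselect (0 < complex.Im w); last by exists 0.
  pose n1 := Num.bound (normc (w - z0)).
  pose n2 := Num.bound (complex.Im z0 / complex.Im w).
  exists (n1 + n2)%N => _; split; rewrite /discN /=.
    rewrite (lt_le_trans (archi_boundP (normc_ge0 _)))// ler_nat.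
    by rewrite -/n1 -addn2 -addnA leq_addr.
  rewrite ltr_pdivrMr ?ltr0n// mulrC -ltr_pdivrMr//.
  have /lt_le_trans : complex.Im z0 / complex.Im w < n2%:R.
    by apply: archi_boundP; rewrite divr_ge0// ltW.
  by apply; rewrite ler_nat -addn2 addnAC leq_addl.
(* The sections [f n] agree at [z0], hence on convex intersections, so the glued value does not
   depend on the chosen index. *)
have gE n w : 0 < complex.Im w -> U n w -> f (N w) w = f n w.
  move=> w0 Uw; have [fN lN] := fP (N w); have [fn ln] := fP n.
  apply: (@lift_unique _ _ _ _ SD (U (N w) `&` U n) id (f (N w)) (f n) z0) => //.
  - exact: convexC_setI.
  - by apply: lift_sub lN => ? [].
  - by apply: lift_sub ln => ? [].
  - by split=> //; exact: NP.
  - by rewrite fN fn.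
exists (fun w => f (N w) w); split; first exact: (fP _).1.
move=> w w0; have [Of Sf cf] := (fP (N w)).2 w (NP w w0); split=> //.
move=> e e0; have [r r0 rP] := cf e e0.
have [Uw1 Uw2] := NP w w0; rewrite /discN /= in Uw1 Uw2.
exists (Num.min r (Num.min ((N w).+2%:R - normc (w - z0))
    (complex.Im w - complex.Im z0 / (N w).+2%:R))).
  by rewrite !lt_min r0 !subr_gt0 Uw1.
move=> v v0; rewrite !lt_min => /and3P[vr v1 v2].
have Uv : U (N w) v.
  split; rewrite /discN /=; first by have := normc_triangle w v z0; lra.
  have := ler_norm_Im (v - w); rewrite ImB ler_norml => /andP[+ _]; move: v2; move: (_ / _) => q; lra.
by rewrite (gE (N w) v)//; exact: rP.
Qed.

Hypothesis Omega_connected : forall V : set R[i], V `<=` Omega -> V x0 ->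
  open_normc V ->
  (forall x, Omega x -> ~ V x -> exists2 r : R, 0 < r &
     forall y, normc (y - x) < r -> Omega y -> ~ V y) ->
  Omega `<=` V.

Lemma half_plane_inverse : (forall x, Omega x -> 0 < complex.Im (S x)) ->
  exists g, lift Omega S [set z | 0 < complex.Im z] id g /\
    forall x, Omega x -> g (S x) = x.
Proof.
move=> Im0; have [g [gz0 lg]] := half_plane_section (Im0 _ Ox0).
exists g; split=> //.
suff : Omega `<=` [set x | Omega x /\ g (S x) = x] by move=> H x /H[].
have gS_continuous x : Omega x -> forall e : R, 0 < e -> exists2 r : R, 0 < r &
    forall y, normc (y - x) < r -> Omega y -> normc (g (S y) - g (S x)) < e.
  move=> Ox e e0; have [_ _ /(_ e e0)[r r0 rP]] := lg _ (Im0 x Ox).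
  have [r' r'0 r'P] := strict_diff_continuous SD Ox r0.
  by exists r' => // y yx Oy; apply: rP; [exact: Im0 | exact: r'P].
apply: Omega_connected => [x []//|//|x [Ox gx]|x Ox].
  (* Openness: near such an [x], [g (S y)] and [y] are both close to [x] with the same image, so
     local injectivity identifies them. *)
  have [_ [r r0 rP]] := locally_expanding SD Ox.
  have [ri ri0 riP] := locally_injective SD Ox.
  have [r' r'0 r'P] := gS_continuous x Ox _ ri0.
  exists (Num.min r (Num.min ri r')); first by rewrite !lt_min r0 ri0.
  move=> y; rewrite !lt_min => /and3P[yr yri yr'].
  have [Oy _] := rP y yr; split=> //; apply: riP => //.
    by rewrite -[in X in _ - X]gx; exact: r'P.
  by have [_ -> _] := lg _ (Im0 y Oy).
(* Relative closedness: by continuity, [g (S y)] and [y] stay apart near a point where [g (S x)] and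
   [x] differ. *)
move=> nV; have gx : g (S x) - x != 0.
  by rewrite subr_eq0; apply/eqP => gx; apply: nV.
have e0 : 0 < normc (g (S x) - x) / 2 by rewrite divr_gt0 ?normc_gt0.
have [r r0 rP] := gS_continuous x Ox _ e0.
exists (Num.min r (normc (g (S x) - x) / 2)); first by rewrite lt_min r0.
move=> y; rewrite lt_min => /andP[yr ye] Oy [_ gy].
have := rP y yr Oy; rewrite gy.
have := normc_triangle y (g (S x)) x; rewrite (normcB (g (S x)) y); lra.
Qed.

End GlobalInverse.

(** * Continuity and growth of complex polynomials *)

Section Polynomials.
Context {R : realType}.
Implicit Types (p : {poly R[i]}) (x : R[i]).

Lemma horner_locally_lipschitz p x : exists2 K : R, 0 <= K &
  forall y, normc (y - x) < 1 -> normc (p.[y] - p.[x]) <= K * normc (y - x).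
Proof.
elim/poly_ind: p => [|p c [K K0 KP]].
  by exists 0 => // y _; rewrite !horner0 subrr normc0 mul0r.
exists (K * (normc x + 1) + normc p.[x]).
  by rewrite addr_ge0 ?mulr_ge0 ?addr_ge0 ?normc_ge0.
move=> y yx; rewrite !hornerE.
have -> : p.[y] * y + c - (p.[x] * x + c) = (p.[y] - p.[x]) * y + p.[x] * (y - x).
  by ring.
rewrite (le_trans (normcD _ _))// !normcM mulrDl lerD2r.
have yx1 : normc y <= normc x + 1 by have := ler_normcB y x; lra.
rewrite mulrAC; apply: ler_pM => //; [exact: normc_ge0..|exact: KP].
Qed.

Lemma horner_continuous_normc p x (Omega : set R[i]) :
  continuous_normc Omega (fun x => p.[x]) x.
Proof.
move=> e e0; have [K K0 KP] := horner_locally_lipschitz p x.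
have K1 : 0 < K + 1 by rewrite ltr_wpDl.
exists (Num.min 1 (e / (K + 1))); first by rewrite lt_min ltr01 divr_gt0.
move=> y _; rewrite lt_min ltr_pdivlMr// => /andP[/KP H1 H2].
by have := normc_ge0 (y - x); nra.
Qed.

(** By Horner's scheme, once [p] is bounded below by [b], [p * 'X + c] has modulus at least
    [b * normc x - normc c]; the threshold makes this at least 1. *)
Lemma horner_bounded_below p : p != 0 -> exists R0 b : R,
  0 < b /\ forall x, R0 <= normc x -> b <= normc p.[x].
Proof.
elim/poly_ind: p => [|p c IH]; first by rewrite eqxx.
have [->|p0] := eqVneq p 0.
  rewrite mul0r add0r polyC_eq0 => c0; exists 0, (normc c).
  by rewrite normc_gt0 c0; split=> // x _; rewrite hornerC.
move=> _; have [R0 [b [b0 bP]]] := IH p0.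
exists (Num.max R0 ((1 + normc c) / b)), 1; split=> // x.
rewrite ge_max ler_pdivrMr// => /andP[/bP bx xb].
rewrite !hornerE; have := ler_normcB (p.[x] * x) (- c).
rewrite opprK normcN normcM; have := normc_ge0 x; nra.
Qed.

Lemma horner_unbounded p : (1 < size p)%N -> exists R0 : R,
  forall x, R0 <= normc x -> 1 <= normc p.[x].
Proof.
elim/poly_ind: p => [|p c _]; first by rewrite size_poly0.
rewrite size_MXaddC; case: ifP => [//|_]; rewrite ltnS size_poly_gt0 => p0.
have [R0 [b [b0 bP]]] := horner_bounded_below p0.
exists (Num.max R0 ((1 + normc c) / b)) => x.
rewrite ge_max ler_pdivrMr// => /andP[/bP bx xb].
rewrite !hornerE; have := ler_normcB (p.[x] * x) (- c).
rewrite opprK normcN normcM; have := normc_ge0 x; nra.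
Qed.

End Polynomials.

(** * Openness, boundary behaviour and connectedness of the domain *)

Section StokesDomain.
Context {R : realType}.
Variables (Omega : set (Cx R)) (S : Cx R -> Cx R).
Hypothesis Im_gt0 : forall x, Omega x -> 0 < complex.Im (S x).
Hypothesis Im_bdry : forall b, bdry Omega b ->
  complex.Im (S x) @[x --> within Omega (nbhs b)] --> (0 : R).

(* A point of [Omega] on its own boundary would have [Im S = 0]. *)
Lemma Im_vanishing_open : open_normc Omega.
Proof.
move=> x Ox; apply/nbhs_normc; apply: contrapT => nOx.
have /Im_bdry/cvgrPdist_lt : bdry Omega x by split=> //; exact: subset_closure.
move=> /(_ _ (Im_gt0 Ox)); rewrite /prop_near1 /within /= => /nbhs_singleton.
by move=> /(_ Ox); rewrite sub0r normrN gtr0_norm ?Im_gt0// ltxx.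
Qed.

(** A point outside the closure has a neighbourhood missing [Omega]; any other point outside [Omega]
    is a boundary point, where [Im S] tends to 0. *)
Lemma Im_vanishing_boundary (x : R[i]) : ~ Omega x -> forall c : R, 0 < c ->
  exists2 e : R, 0 < e &
    forall y, Omega y -> normc (y - x) < e -> complex.Im (S y) < c.
Proof.
move=> nOx c c0; have [clx|] := pselect (closure Omega (x : Cx R)); last first.
  move=> /existsNP[B] /not_implyP[/nbhs_normc[e e0 eB]] /set0P/negP; rewrite negbK => /eqP OB0.
  exists e => // y Oy /eB By; exfalso.
  by have : (Omega `&` B) y by []; rewrite OB0.
have /Im_bdry/cvgrPdist_lt : bdry Omega x.
  by split=> // /interior_subset.
move=> /(_ _ c0); rewrite /prop_near1 /within /= => /nbhs_normc[e e0 eP].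
exists e => // y Oy /eP/(_ Oy); rewrite sub0r normrN.
exact: le_lt_trans (ler_norm _).
Qed.

Lemma connected_normc (V : set R[i]) (x0 : R[i]) : connected Omega ->
  V `<=` Omega -> V x0 -> open_normc V ->
  (forall x, Omega x -> ~ V x -> exists2 r : R, 0 < r &
     forall y, normc (y - x) < r -> Omega y -> ~ V y) ->
  Omega `<=` V.
Proof.
move=> cO VO Vx0 oV cV.
have <- // : V = Omega.
apply: cO; first by exists x0.
  exists (V : set (Cx R)); last by apply/seteqP; split=> [x Vx|x []//]; split=> //; exact: VO.
  by rewrite openE => x /oV /nbhs_normc.
exists (closure (V : set (Cx R))); first exact: closed_closure.
apply/seteqP; split=> [x Vx|x [Ox clx]].
  by split; [exact: VO | exact: (@subset_closure (Cx R))].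
apply: contrapT => nVx; have [r r0 rP] := cV x Ox nVx.
have /clx[y [Vy yr]] : nbhs (x : Cx R) [set y : Cx R | normc (y - x) < r].
  by apply/nbhs_normc; exists r.
exact: rP yr (VO _ Vy) Vy.
Qed.

End StokesDomain.

Theorem theorem5p3 (R : realType) (Q : {poly R[i]}) (Omega : set (Cx R))
    (a : Cx R) (S : Cx R -> Cx R) :
  (1 < size Q)%N ->
  stokes_domain Q Omega ->
  turning_point Q a -> bdry Omega a ->
  (* S = S_a : holomorphic on Omega, S' a branch of sqrt Q, S(x) -> 0 at a *)
  (forall x, Omega x -> derivable S x 1 /\ ('D_1 S x) ^+ 2 = Q.[x]) ->
  S x @[x --> within Omega (nbhs a)] --> (0 : Cx R) ->
  (forall x, Omega x -> 0 < complex.Im (S x)) ->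
  (* type (1) *)
  connected (bdry Omega) ->
  (forall b, bdry Omega b ->
     complex.Im (S x) @[x --> within Omega (nbhs b)] --> (0 : R)) ->
  (* conclusion: S is a biholomorphic map of Omega onto C_+ *)
  [/\ forall x, Omega x -> derivable S x 1 /\ 'D_1 S x != 0,
      forall x y, Omega x -> Omega y -> S x = S y -> x = y,
      S @` Omega = @upper_half_plane R &
      exists g : Cx R -> Cx R,
        (forall z, @upper_half_plane R z ->
           [/\ derivable g z 1, Omega (g z) & S (g z) = z]) /\
        (forall x, Omega x -> g (S x) = x)].
Proof.
move=> szQ [x1 [x1G OmegaE]] _ _ SQ _ Im_gt0 _ Im_bdry.
have Ox1 : Omega x1.
  by rewrite OmegaE; exact: connected_component_refl.
have cO : connected Omega by rewrite OmegaE; exact: component_connected.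
have Q0 x : Omega x -> Q.[x] != 0.
  rewrite OmegaE => /connected_component_sub nG.
  by apply/negP => Qx; apply: nG; left.
pose D (x : R[i]) : R[i] := 'D_1 S x.
have SD : strict_diff Omega S D.
  apply: (@square_root_primitive_strict_diff _ S D (fun x => Q.[x])).
  - exact: Im_vanishing_open Im_gt0 Im_bdry.
  - by move=> x /SQ[dS D2]; split=> //; exact: derivable_cdiff.
  - by move=> x Ox; split; [exact: horner_continuous_normc | exact: Q0].
have [R0 R0P] := horner_unbounded szQ.
(* The square of [D x] is [Q.[x]], of modulus at least 1 there. *)
have D_ge1 x : Omega x -> R0 <= normc x -> 1 <= normc (D x).
  move=> Ox /R0P; have [_ <-] := SQ x Ox.
  rewrite -[normc (_ ^+ 2)]/(normc (D x * D x)) normcM.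
  by have := normc_ge0 (D x); nra.
have [||g [lg gS]] := half_plane_inverse SD (Im_vanishing_boundary Im_bdry) D_ge1 Ox1.
- by move=> V; exact: connected_normc.
- exact: Im_gt0.
split.
- by move=> x Ox; split; [exact: (SQ x Ox).1 | exact: (SD x Ox).1].
- by move=> x y Ox Oy Sxy; rewrite -(gS x Ox) Sxy gS.
- apply/seteqP; split=> [z [x Ox <-]|z z0]; first exact: Im_gt0.
  by have [Og Sg _] := lg z z0; exists (g z).
exists g; split=> // z z0; have [Og Sg _] := lg z z0; split=> //.
apply: (@cdiff_derivable _ _ _ (D (g z))^-1).
(* The disc of radius [Im z] about [z] lies in the upper half-plane. *)
apply: (@section_cdiff _ Omega S D SD g z (complex.Im z)) => //.
apply: lift_sub lg => w; rewrite /discN /= => wz.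
by have := ler_norm_Im (w - z); rewrite ImB ler_norml => /andP[+ _]; lra.
Qed.
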